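(* Let $S$ be a semigroup that admits a bounded below weight $\omega$ for which the associated function $\Omega$ is $0$-cluster. Then $S$ is countable in each of the following cases: (1) $S$ is a Brandt semigroup; (2) $S$ is weakly cancellative; (3) $S$ is a simple inverse semigroup (resp. a $0$-simple inverse semigroup); (4) $S$ is an inverse semigroup with finitely many idempotents.
   Context: A weight on a semigroup $S$ is a function $\omega:S\to(0,\infty)$ with $\omega(st)\le\omega(s)\omega(t)$ for all $s,t\in S$. It is bounded below if $\inf_{s\in S}\omega(s)>0$. The function $\Omega:S\times S\to(0,1]$ associated with $\omega$ is $\Omega(s,t)=\frac{\omega(st)}{\omega(s)\omega(t)}$. $\Omega$ is called $0$-cluster if for each pair of sequences $(x_n)$, $(y_m)$, each consisting of distinct elements of $S$, one has $\lim_n\lim_m\Omega(x_n,y_m)=0=\lim_m\lim_n\Omega(x_n,y_m)$ whenever both iterated limits exist. ''Countable'' means finite or countably infinite. A semigroup $S$ is weakly cancellative if for all $s,t\in S$ the sets $\{x\in S: sx=t\}$ and $\{x\in S: xs=t\}$ are finite. An inverse semigroup is a semigroup in which every $s$ has a unique $s^*$ with $ss^*s=s$ and $s^*ss^*=s^*$. A semigroup is simple if it has no proper (two-sided) ideals; a semigroup with zero $0$ is $0$-simple if $S^2\neq\{0\}$ and its only ideals are $\{0\}$ and $S$. A Brandt semigroup is a semigroup (isomorphic to one) of the form $(I\times G\times I)\cup\{0\}$, where $G$ is a group and $I$ is a nonempty set, with multiplication $(i,a,j)(k,b,l)=(i,ab,l)$ if $j=k$, $(i,a,j)(k,b,l)=0$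 if $j\ne k$, and all products involving $0$ equal to $0$. *)

(* Defs.v *)
From HB Require Import structures.
From mathcomp Require Import all_boot all_order all_algebra.
From mathcomp Require Import all_classical all_reals all_analysis.

Set Implicit Arguments.
Unset Strict Implicit.
Unset Printing Implicit Defensive.

Import Order.TTheory GRing.Theory Num.Theory.
Import numFieldNormedType.Exports.

Local Open Scope classical_set_scope.
Local Open Scope ring_scope.

Section Weights.
Variables (R : realType) (S : semigroupType).
Implicit Types (w : S -> R) (Om : S -> S -> R).

Definition weight w :=
  (forall s, 0 < w s) /\ (forall s t, w (s * t)%g <= w s * w t).

(* On a nonempty [S] a weight has a genuine infimum, since it is bounded below
   by 0 (the library sets [inf] to 0 when there is no infimum). *)
Definition bounded_below w := 0 < inf (range w).

Definition weight_ratio w (s t : S) : R := w (s * t)%g / (w s * w t).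

(* The iterated limits exist when every inner limit [f n] (resp. [g m]) exists
   and the sequence [f] (resp. [g]) converges. *)
Definition zero_cluster Om :=
  forall x y : nat -> S, injective x -> injective y ->
  forall (f g : nat -> R) (a b : R),
    (forall n, Om (x n) (y m) @[m --> \oo] --> f n) ->
    f n @[n --> \oo] --> a ->
    (forall m, Om (x n) (y m) @[n --> \oo] --> g m) ->
    g m @[m --> \oo] --> b ->
  a = 0 /\ b = 0.

End Weights.

Section SemigroupClasses.
Variable S : semigroupType.

Definition weakly_cancellative :=
  forall s t : S, finite_set [set x | (s * x)%g = t] /\
                  finite_set [set x | (x * s)%g = t].

Definition inverse_semigroup :=
  forall s : S, exists! t : S, (s * t * s)%g = s /\ (t * s * t)%g = t.

Definition idempotents : set S := [set e | (e * e)%g = e].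

Definition ideal (J : set S) :=
  J !=set0 /\ forall s t : S, J t -> J (s * t)%g /\ J (t * s)%g.

Definition simple_semigroup := forall J : set S, ideal J -> J = setT.

Definition is_zero (z : S) := forall s : S, (z * s)%g = z /\ (s * z)%g = z.

Definition zero_simple_semigroup :=
  exists z : S, [/\ is_zero z,
    [set (s * t)%g | s in [set: S] & t in [set: S]] <> [set z] &
    forall J : set S, ideal J -> J = [set z] \/ J = setT].

End SemigroupClasses.

(* [None] is the adjoined zero. *)
Definition brandt (I : choiceType) (G : groupType) := option (I * G * I).

Section Brandt.
Variables (I : choiceType) (G : groupType).

Definition brandt_mul (s t : brandt I G) : brandt I G :=
  match s, t with
  | Some (i, a, j), Some (k, b, l) =>
      if j == k then Some (i, (a * b)%g, l) else None
  | _, _ => None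
  end.

Lemma brandt_mulA : associative brandt_mul.
Proof.
move=> [[[i a] j]|] [[[k b] l]|] [[[m c] n]|] //=; do ?by case: ifP.
by case: (l =P m) => lm; case: (j =P k) => jk //=;
  rewrite ?jk ?lm ?eqxx ?monoid.mulgA //; case: eqP.
Qed.

HB.instance Definition _ := Choice.on (brandt I G).
HB.instance Definition _ := isSemigroup.Build (brandt I G) brandt_mulA.

End Brandt.

Definition brandt_semigroup (S : semigroupType) :=
  exists (I : choiceType) (G : groupType) (f : brandt I G -> S),
    [/\ inhabited I, bijective f & {morph f : s t / (s * t)%g}].

(* Main.v *)
(* Put S_n = {s | w s <= n}; these sets cover S.  If w >= d > 0, then
   Omega(s, t) >= d / n^2 for s, t in S_n.  If some S_n were infinite, a sequence
   of distinct elements of it would have a subsequence along which both iterated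
   limits of Omega exist; they would be at least d / n^2 > 0, against the
   0-cluster property.  So every S_n is finite and S is countable. *)
Require Import Defs.
From mathcomp Require Import all_boot all_order all_algebra.
From mathcomp Require Import all_classical all_reals all_analysis.

Local Open Scope classical_set_scope.
Local Open Scope ring_scope.

Import Order.TTheory GRing.Theory Num.Theory.
Import numFieldNormedType.Exports.

(** Terms are chosen recursively: the terms already chosen impose finitely many conditions on the
    next one, and finitely many [F]-large sets have a common point. *)
Lemma filter_diagonal_choice (F : set_system nat) {FF : ProperFilter F}
    (P : nat -> nat -> nat -> Prop) :
  (forall j p, \forall q \near F, P j p q) ->
  exists k : nat -> nat, forall i j, (i < j)%N -> P j (k i) (k j).
Proof.
move=> FP.
have next (s : seq nat) : exists q, forall p, p \in s -> P (size s) p q.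
  (* The stage [size s] is frozen as [j], so that it stays fixed during the induction on [s]. *)
  apply: (@filter_ex _ F); move: (size s) => j; elim: s => [|p s IHs].
    by apply: nearW.
  apply: filterS2 IHs (FP j p) => q IHq Pq p'.
  by rewrite inE => /predU1P[->|/IHq].
have [c cP] := choice next.
(* [L n] lists the first [n] chosen terms, latest first. *)
pose L n := iter n (fun s => c s :: s) [::].
have sizeL n : size (L n) = n by elim: n => //= n ->.
have memL i j : (i < j)%N -> c (L i) \in L j.
  elim: j => // j IHj; rewrite ltnS leq_eqVlt => /predU1P[->|/IHj ij].
    exact: mem_head.
  by rewrite inE ij orbT.
by exists (c \o L) => i j /memL/cP; rewrite sizeL.
Qed.

Lemma cvg_near_inv_succ {R : realType} (u : nat -> R) (l : R) (N : nat) :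
  (forall n, (N < n)%N -> `|l - u n| < n.+1%:R^-1) -> u @ \oo --> l.
Proof.
move=> ul; apply/cvgrPdist_lt => e e0.
near=> n; apply: lt_trans (ul n _) _.
  by near: n; exact: nbhs_infty_gt.
near: n; exact: near_infty_natSinv_lt (PosNum e0).
Unshelve. all: by end_near. Qed.

(** The image of an ultrafilter is an ultrafilter, and on a compact segment every ultrafilter
    converges. *)
Lemma ultra_cvg_segment {R : realType} (U : set_system nat)
    {UU : UltraFilter U} (lo hi : R) (u : nat -> R) :
  (forall n, lo <= u n <= hi) ->
  exists2 l, lo <= l <= hi & u @ U --> l.
Proof.
move=> ub.
have uU : UltraFilter (u @ U).
  split; first exact: fmap_proper_filter.
  move=> G GF uG; rewrite predeqE => A; split => [GA|/uG//].
  have [//|UnA] := in_ultra_setVsetC (u @^-1` A) UU.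
  have [] : (A `&` ~` A) !=set0; last by move=> x [].
  by apply: (@filter_ex _ G); apply: filterI => //; exact: uG.
have := @segment_compact R lo hi; rewrite compact_ultra => /(_ (u @ U) uU)[].
  by apply: (@filterE _ U) => n /=; rewrite in_itv/= ub.
by move=> l [/=]; rewrite in_itv/=; exists l.
Qed.

(* The limits are taken along a nonprincipal ultrafilter, and the subsequence is
   then chosen term by term so that it realizes all of them at once. *)
Lemma subsequence_iterated_limits {R : realType} (lo hi : R)
    (A : nat -> nat -> R) (Ab : forall n m, lo <= A n m <= hi) :
  exists k : nat -> nat, injective k /\
  exists (f g : nat -> R) (a b : R),
    [/\ forall n, A (k n) (k m) @[m --> \oo] --> f n,
        f n @[n --> \oo] --> a,
        forall m, A (k n) (k m) @[n --> \oo] --> g m,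
        g m @[m --> \oo] --> b & lo <= a].
Proof.
have [U [UU ooU]] := @ultraFilterLemma nat \oo _.
have row n : exists l, lo <= l <= hi /\ A n @ U --> l.
  by have [l] := ultra_cvg_segment U lo hi _ (Ab n); exists l.
have col m : exists l, lo <= l <= hi /\ (A^~ m) @ U --> l.
  by have [l] := ultra_cvg_segment U lo hi _ (Ab^~ m); exists l.
have [f fP] := choice row; have [g gP] := choice col.
have [a /andP[lea _] fa] := ultra_cvg_segment U lo hi f (fun n => (fP n).1).
have [b _ gb] := ultra_cvg_segment U lo hi g (fun n => (gP n).1).
(* Here [p] is an earlier term, [q] the new one, and the stage [j] sets the precision. The condition
   [p < q], which is [U]-large because [U] refines [\oo], makes [k] injective. *)
have [] := @filter_diagonal_choice U _ (fun j p q =>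
    [/\ (p < q)%N, `|f p - A p q| < j.+1%:R^-1, `|g p - A q p| < j.+1%:R^-1,
        `|a - f q| < j.+1%:R^-1 & `|b - g q| < j.+1%:R^-1]).
  move=> j p.
  have e0 : 0 < j.+1%:R^-1 :> R by rewrite invr_gt0.
  have Upq := ooU _ (nbhs_infty_gt p).
  have Uf := cvgr_dist_lt _ _ (fP p).2 _ e0.
  have Ug := cvgr_dist_lt _ _ (gP p).2 _ e0.
  have Ua := cvgr_dist_lt _ _ fa _ e0.
  have Ub := cvgr_dist_lt _ _ gb _ e0.
  near=> q; split; near: q;
    [exact: Upq|exact: Uf|exact: Ug|exact: Ua|exact: Ub].
move=> k kP; exists k; split.
  move=> i j kij; have [/kP[]|/kP[]|//] := ltngtP i j;
    by rewrite kij ltnn.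
exists (f \o k), (g \o k), a, b; split => //.
(* Inner limits are controlled only past the fixed index; outer ones from index 1 on, since each
   bound comes with an earlier term. *)
- by move=> n; apply: (cvg_near_inv_succ _ _ n) => m /kP[].
- by apply: (cvg_near_inv_succ _ _ 0) => m /kP[].
- by move=> m; apply: (cvg_near_inv_succ _ _ m) => n /kP[].
- by apply: (cvg_near_inv_succ _ _ 0) => m /kP[].
Unshelve. all: by end_near. Qed.

Lemma infinite_set_sequence {T : Type} (A : set T) : infinite_set A ->
  exists u : nat -> T, injective u /\ forall n, A (u n).
Proof.
(* An empty type has no infinite subset; otherwise [T] may be taken pointed. *)
elim/Ppointed: T => T in A *.
  by rewrite emptyE => /(_ (finite_set0 _)).
move=> /infiniteP/ppcard_leP[u]; exists u; split.
  by move=> i j; apply: (@inj _ _ _ u); rewrite inE.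
by move=> n; exact: (@funS _ _ _ _ u).
Qed.

Section BoundedBelowWeight.
Context {R : realType} {S : semigroupType} (w : S -> R).
Hypotheses (ww : weight w) (wb : bounded_below w).

Lemma inf_weight_le s : inf (range w) <= w s.
Proof.
apply: ge_inf; last by exists s.
by exists 0 => _ [t _ <-]; apply/ltW/ww.1.
Qed.

Lemma weight_ratio_le1 s t : weight_ratio w s t <= 1.
Proof.
by rewrite /weight_ratio ler_pdivrMr ?mul1r; [exact: ww.2|
  rewrite mulr_gt0 ?ww.1].
Qed.

(** The numerator is at least the infimum and the denominator at most [c * c]. *)
Lemma weight_ratio_ge (c : R) s t : w s <= c -> w t <= c ->
  inf (range w) / (c * c) <= weight_ratio w s t.
Proof.
move=> sc tc; have ws := ww.1 s; have wt := ww.1 t.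
have c0 : 0 < c by exact: lt_le_trans sc.
apply: ler_pM; rewrite ?invr_ge0 ?(ltW wb) ?inf_weight_le//.
  by rewrite mulr_ge0 ?ltW.
by rewrite lef_pV2 ?posrE ?mulr_gt0// (ler_pM (ltW ws) (ltW wt) sc tc).
Qed.

Lemma zero_cluster_finite_sublevel (c : R) :
  zero_cluster (weight_ratio w) -> finite_set [set s | w s <= c].
Proof.
move=> w0; apply: contrapT => /infinite_set_sequence[u [uI uc]].
have d0 : 0 < inf (range w) / (c * c).
  have c0 : 0 < c := lt_le_trans (ww.1 _) (uc 0%N).
  by rewrite divr_gt0 ?mulr_gt0.
have [k [kI [f [g [a [b [kf fa kg gb da]]]]]]] :=
  subsequence_iterated_limits (inf (range w) / (c * c)) 1
    (fun n m => weight_ratio w (u n) (u m))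
    (fun n m => introT andP
      (conj (weight_ratio_ge _ _ _ (uc n) (uc m)) (weight_ratio_le1 _ _))).
(* The single sequence [u \o k] serves as both [x] and [y]. *)
have [a0 _] := w0 _ _ (inj_comp uI kI) (inj_comp uI kI) f g a b kf fa kg gb.
by move: da; rewrite a0 leNgt d0.
Qed.

Lemma zero_cluster_countable :
  zero_cluster (weight_ratio w) -> countable [set: S].
Proof.
move=> w0.
have -> : [set: S] = \bigcup_(n in [set: nat]) [set s | w s <= n%:R].
  apply/esym; rewrite -subTset => s _.
  by exists (Num.bound (w s)) => //=; apply/ltW/archi_boundP/ltW/ww.1.
apply: bigcup_countable => // n _.
exact/finite_set_countable/zero_cluster_finite_sublevel.
Qed.

End BoundedBelowWeight.

Theorem theorem3p4 (R : realType) (S : semigroupType)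
    (hS : exists w : S -> R,
      [/\ weight w, bounded_below w & zero_cluster (weight_ratio w)]) :
  [/\ brandt_semigroup S -> countable [set: S],
      weakly_cancellative S -> countable [set: S],
      inverse_semigroup S /\ simple_semigroup S -> countable [set: S],
      inverse_semigroup S /\ zero_simple_semigroup S -> countable [set: S] &
      inverse_semigroup S /\ finite_set (@idempotents S) -> countable [set: S]].
Proof.
case: hS => w [ww wb w0].
have S_countable : countable [set: S] by exact: zero_cluster_countable w0.
by split.
Qed.
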